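(* Let $\mathcal{F}:\mathbb{F}_{q^t}^r\to\mathbb{F}_q^{rt}$ be a vfr-map, $L$ an $\mathbb{F}_q$-linear set of $\mathrm{PG}(r-1,q^t)$ and $n\geq1$. If Condition (B) holds for $(L,n)$, then Condition (A) holds for $(L,n)$.
   Context: A vfr-map $\mathcal{F}:\mathbb{F}_{q^t}^r\to\mathbb{F}_q^{rt}$ is an $\mathbb{F}_q$-linear bijection (e.g. obtained by fixing an $\mathbb{F}_q$-basis of $\mathbb{F}_{q^t}$ and taking coordinates). Points of $\mathrm{PG}(rt-1,q)$ are $\langle w\rangle_q$, points of $\mathrm{PG}(r-1,q^t)$ are $\langle v\rangle_{q^t}$; for a subspace $U$ of $\mathbb{F}_q^{rt}$, $\langle U\rangle_q$ is the projective subspace it determines. $\mathcal{D}=\{\{\langle\mathcal{F}(\alpha v)\rangle_q\mid\alpha\in\mathbb{F}_{q^t}^*\}\mid v\in\mathbb{F}_{q^t}^r\setminus\{0\}\}$ is the Desarguesian spread obtained from $\mathcal{F}$; its element determined by $v$ corresponds to the point $\langle v\rangle_{q^t}$. For an $\mathbb{F}_q$-subspace $U$, $\mathcal{B}(U)=\{\langle v\rangle_{q^t}\mid v\in\mathcal{F}^{-1}(U\setminus\{0\})\}$ and $\mathcal{B}(\langle U\rangle_q)=\mathcal{B}(U)$; such sets are $\mathbb{F}_q$-linear sets. For $\beta\in\mathbb{F}_{q^t}^*$, $\mathcal{F}(m_\beta)$ is the map on $\mathbb{F}_q^{rt}$ with $\mathcal{F}(m_\beta)(\mathcal{F}(v))=\mathcal{F}(\beta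 v)$. Condition (A) for $(L,n)$: for any two $(n-1)$-dimensional subspaces $\pi,\pi'$ of $\mathrm{PG}(rt-1,q)$ with $\mathcal{B}(\pi)=L=\mathcal{B}(\pi')$, there is $\gamma\in\mathrm{P}\Gamma\mathrm{L}(rt,q)$ with (a) $\gamma(\pi)=\pi'$, (b) $\gamma$ preserves $\mathcal{D}$, (c) the map induced by $\gamma$ on $\mathrm{PG}(r-1,q^t)$ is a collineation. Condition (B) for $(L,n)$: whenever $U,U'$ are $n$-dimensional $\mathbb{F}_q$-subspaces of $\mathbb{F}_q^{rt}$ with $\mathcal{B}(U)=L=\mathcal{B}(U')$, then $U'=\mathcal{F}(m_\beta)(U)$ for some $\beta\in\mathbb{F}_{q^t}^*$. *)

(* Defs.v *)
From mathcomp Require Import all_boot all_order all_algebra all_field.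
From mathcomp Require Import boolp classical_sets.

Set Implicit Arguments.
Unset Strict Implicit.
Unset Printing Implicit Defensive.

Import GRing.Theory.

Local Open Scope ring_scope.
Local Open Scope classical_set_scope.

(* Points of PG(m-1, E). *)
Definition pg_point (E : fieldType) (m : nat) :=
  {P : {vspace 'rV[E]_m} | \dim P == 1%N}.

(* The projective subspace <U> determined by U, as a set of points. *)
Definition pg_span (E : fieldType) (m : nat) (U : {vspace 'rV[E]_m}) :
    set (pg_point E m) :=
  [set P | (val P <= U)%VS].

Lemma pg_span_inj (E : fieldType) (m : nat) : injective (@pg_span E m).
Proof.
suff sub (U V : {vspace 'rV[E]_m}) : pg_span U = pg_span V -> (U <= V)%VS.
  by move=> U V UV; apply/eqP; rewrite eqEsubv !sub.
move=> UV; apply/subvP => w wU; have [->|w0] := eqVneq w 0; first exact: mem0v.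
have w1 : \dim <[w]>%VS == 1%N by rewrite dim_vline w0.
pose Pw : pg_point E m := exist (fun P : {vspace _} => \dim P == 1%N) _ w1.
have : pg_span U Pw by rewrite /pg_span /= -memvE.
by rewrite UV /pg_span /= -memvE.
Qed.

(* d is the projective dimension. *)
Definition is_pg_subspace (E : fieldType) (m d : nat)
    (pi : set (pg_point E m)) : Prop :=
  exists2 U : {vspace 'rV[E]_m}, \dim U = d.+1 & pi = pg_span U.

Definition semilinear_map (E : fieldType) (m : nat) (sigma : E -> E)
    (g : 'rV[E]_m -> 'rV[E]_m) : Prop :=
  (forall u v, g (u + v) = g u + g v) /\
  (forall a u, g (a *: u) = sigma a *: g u).

(* Elements of PGammaL(m, E), as maps on points. *)
Definition is_PGammaL (E : fieldType) (m : nat)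
    (gamma : pg_point E m -> pg_point E m) : Prop :=
  exists (sigma : {rmorphism E -> E}) (g : 'rV[E]_m -> 'rV[E]_m),
    [/\ bijective sigma, bijective g, semilinear_map sigma g &
        forall (P : pg_point E m) (w : 'rV[E]_m),
          val P = <[w]>%VS -> val (gamma P) = <[g w]>%VS].

(* Collineations are the elements of PGammaL: on a projective line, preserving
   collinearity would be no condition at all. *)
Definition is_collineation (E : fieldType) (m : nat)
    (phi : pg_point E m -> pg_point E m) : Prop := is_PGammaL phi.

(* F_q is F and F_{q^t} is K.  The F-action on 'rV[K]_r is through the
   embedding a |-> a%:A of F in K. *)
Record vfr_map (F : finFieldType) (K : fieldExtType F) (r t : nat) := VfrMap {
  vfr_fun :> 'rV[K]_r -> 'rV[F]_(r * t);
  vfr_inv : 'rV[F]_(r * t) -> 'rV[K]_r;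
  vfr_funK : cancel vfr_fun vfr_inv;
  vfr_invK : cancel vfr_inv vfr_fun;
  vfr_funD : forall u v, vfr_fun (u + v) = vfr_fun u + vfr_fun v;
  vfr_funZ : forall (a : F) v, vfr_fun (a%:A *: v) = a *: vfr_fun v }.

Section FieldReduction.

Variables (F : finFieldType) (K : fieldExtType F) (r t : nat).
Variable (f : vfr_map K r t).

Definition spread_element (v : 'rV[K]_r) : set (pg_point F (r * t)) :=
  [set P | exists2 alpha : K, alpha != 0 & val P = <[f (alpha *: v)]>%VS].

Definition desarguesian_spread : set (set (pg_point F (r * t))) :=
  [set S | exists2 v : 'rV[K]_r, v != 0 & S = spread_element v].

Definition linset (U : {vspace 'rV[F]_(r * t)}) : set (pg_point K r) :=
  [set P | exists v : 'rV[K]_r,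
      [/\ v != 0, f v \in U & val P = <[v]>%VS]].

(* B(<U>) = B(U); see linset_pg_span for well-definedness. *)
Definition linset_pg (pi : set (pg_point F (r * t))) : set (pg_point K r) :=
  [set P | exists2 U : {vspace 'rV[F]_(r * t)}, pi = pg_span U & linset U P].

Definition is_linear_set (L : set (pg_point K r)) : Prop :=
  exists U : {vspace 'rV[F]_(r * t)}, L = linset U.

(* The map F(m_beta). *)
Definition vfr_mul (beta : K) (w : 'rV[F]_(r * t)) : 'rV[F]_(r * t) :=
  f (beta *: vfr_inv f w).

Definition preserves_spread
    (gamma : pg_point F (r * t) -> pg_point F (r * t)) : Prop :=
  [set gamma @` S | S in desarguesian_spread] = desarguesian_spread.

(* phi is the map on points <v> obtained by identifying <v> with the spread
   element determined by v. *)
Definition induces (gamma : pg_point F (r * t) -> pg_point F (r * t))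
    (phi : pg_point K r -> pg_point K r) : Prop :=
  forall (P : pg_point K r) (v v' : 'rV[K]_r),
    val P = <[v]>%VS -> val (phi P) = <[v']>%VS ->
    gamma @` spread_element v = spread_element v'.

Definition condition_A (L : set (pg_point K r)) (n : nat) : Prop :=
  forall pi pi' : set (pg_point F (r * t)),
    is_pg_subspace n.-1 pi -> is_pg_subspace n.-1 pi' ->
    linset_pg pi = L -> linset_pg pi' = L ->
    exists gamma : pg_point F (r * t) -> pg_point F (r * t),
      [/\ is_PGammaL gamma,
          gamma @` pi = pi',
          preserves_spread gamma &
          exists2 phi : pg_point K r -> pg_point K r,
            induces gamma phi & is_collineation phi].

Definition condition_B (L : set (pg_point K r)) (n : nat) : Prop :=
  forall U U' : {vspace 'rV[F]_(r * t)},
    \dim U = n -> \dim U' = n -> linset U = L -> linset U' = L ->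
    exists2 beta : K, beta != 0 & [set` U'] = vfr_mul beta @` [set` U].

Lemma vfr_mulE beta v : vfr_mul beta (f v) = f (beta *: v).
Proof. by rewrite /vfr_mul vfr_funK. Qed.

Lemma linset_pg_span U : linset_pg (pg_span U) = linset U.
Proof.
apply/seteqP; split => P /=; last by exists U.
by case=> V /pg_span_inj ->.
Qed.

Lemma spread_element_inj (v w : 'rV[K]_r) :
  v != 0 -> spread_element v = spread_element w -> <[v]>%VS = <[w]>%VS.
Proof.
move=> v0 vw; have f0 : f 0 = 0 by apply: (addrI (f 0)); rewrite -vfr_funD !addr0.
have fv0 : f v != 0.
  by apply: contraNneq v0 => fv0; rewrite -(vfr_funK f v) fv0 -f0 vfr_funK.
have p1 : \dim <[f v]>%VS == 1%N by rewrite dim_vline fv0.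
pose Pv : pg_point F (r * t) := exist (fun P : {vspace _} => \dim P == 1%N) _ p1.
have : spread_element v Pv.
  by exists 1; rewrite ?oner_neq0 ?scale1r.
rewrite vw => -[a a0 /= fvE].
have /vlineP[c] : f v \in <[f (a *: w)]>%VS by rewrite -fvE memv_line.
rewrite -vfr_funZ scalerA => /(can_inj (vfr_funK f)) vE.
apply/eqP; rewrite eqEdim !dim_vline v0 -memvE vE memvZ ?memv_line //.
by case: (w != 0).
Qed.

(* The map induced by gamma is unique when it exists. *)
Lemma induces_inj gamma phi psi : induces gamma phi -> induces gamma psi ->
  phi = psi.
Proof.
have ptE (P : pg_point K r) : exists2 v : 'rV[K]_r, v != 0 & val P = <[v]>%VS.
  have Pd := eqP (valP P); exists (vpick (val P)).
    by rewrite vpick0 -dimv_eq0 Pd.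
  apply/esym/eqP; rewrite eqEdim Pd dim_vline vpick0 -dimv_eq0 Pd andbT.
  by rewrite -memvE memv_pick.
move=> Hphi Hpsi; apply/funext => P; apply: val_inj.
have [v v0 Pv] := ptE P; have [w w0 pw] := ptE (phi P).
have [w' _ pw'] := ptE (psi P); rewrite pw pw'.
by apply: spread_element_inj => //; rewrite -(Hphi _ _ _ Pv pw) (Hpsi _ _ _ Pv pw').
Qed.

End FieldReduction.

(* Main.v *)
Require Import Defs.
From HB Require Import structures.
From mathcomp Require Import all_boot all_order all_algebra all_field.
From mathcomp Require Import boolp classical_sets.

(** A scalar multiplication m_beta fixes every point of PG(r-1,q^t), so F(m_beta)
    fixes every element of the Desarguesian spread and induces the identity.
    The map F(m_beta) provided by Condition (B) is therefore an element gamma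
    as required by Condition (A). *)

Set Implicit Arguments.
Unset Strict Implicit.
Unset Printing Implicit Defensive.

Import GRing.Theory.

Local Open Scope ring_scope.
Local Open Scope classical_set_scope.

Section ProjectiveImage.

Variables (E : fieldType) (m : nat).

Lemma pg_pointP (P : pg_point E m) :
  exists2 w : 'rV[E]_m, w != 0 & val P = <[w]>%VS.
Proof.
have Pd := eqP (valP P); have w0 : vpick (val P) != 0.
  by rewrite vpick0 -dimv_eq0 Pd.
exists (vpick (val P)) => //; apply/esym/eqP.
by rewrite eqEdim Pd dim_vline w0 andbT -memvE memv_pick.
Qed.

Lemma pg_point_neq0 (P : pg_point E m) (w : 'rV[E]_m) :
  val P = <[w]>%VS -> w != 0.
Proof. by move=> Pw; have := valP P; rewrite Pw dim_vline eqb1. Qed.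

Variables (h : 'End('rV[E]_m)) (kerh : lker h == 0%VS).

Lemma pg_image_subproof (P : pg_point E m) : \dim (h @: val P)%VS == 1%N.
Proof. by rewrite limg_dim_eq ?(eqP kerh) ?capv0 // (valP P). Qed.

Definition pg_image (P : pg_point E m) : pg_point E m :=
  exist (fun Q : {vspace 'rV[E]_m} => \dim Q == 1%N) _ (pg_image_subproof P).

Lemma pg_imageE P w : val P = <[w]>%VS -> val (pg_image P) = <[h w]>%VS.
Proof. by move=> /= ->; rewrite limg_line. Qed.

(** A linear map is semilinear with the identity as companion automorphism, and an endomorphism with
    trivial kernel has a two-sided inverse in finite dimension. *)
Lemma pg_image_PGammaL : is_PGammaL pg_image.
Proof.
exists (idfun : {rmorphism E -> E}), h; split.
- by exists idfun.
- by exists (h^-1)%VF; [exact: lker0_lfunK | exact: lker0_lfunVK].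
- by split=> [u v|a u]; rewrite (linearD, linearZ).
- exact: pg_imageE.
Qed.

Lemma pg_image_span U : pg_image @` pg_span U = pg_span (h @: U)%VS.
Proof.
apply/seteqP; split=> [_ [P PU <-]|Q]; first exact: limgS.
have [w w0 Qw] := pg_pointP Q; rewrite /pg_span /= Qw -memvE.
case/memv_imgP=> u uU wE.
(* The preimage point is [<[u]>]; it is a point because [h u = w] is nonzero. *)
have u1 : \dim <[u]>%VS == 1%N.
  by rewrite dim_vline eqb1; apply: contraNneq w0 => u0; rewrite wE u0 linear0.
exists (exist (fun P : {vspace _} => \dim P == 1%N) _ u1); first by rewrite /= -memvE.
by apply: val_inj; rewrite Qw wE; apply: pg_imageE.
Qed.

End ProjectiveImage.

Section ScalarMultiplication.

Variables (F : finFieldType) (K : fieldExtType F) (r t : nat).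
Variable f : vfr_map K r t.

(** Two generators of the same point differ by a factor [c != 0], and multiplication by [c] permutes
    the nonzero scalars [alpha] that sweep out a spread element. *)
Lemma spread_element_line (v w : 'rV[K]_r) :
  v != 0 -> <[v]>%VS = <[w]>%VS -> spread_element f v = spread_element f w.
Proof.
move=> v0 vw; have /vlineP[c vE] : v \in <[w]>%VS by rewrite -vw memv_line.
have c0 : c != 0 by apply: contraNneq v0 => c0; rewrite vE c0 scale0r.
apply/seteqP; split=> P [a a0 PE].
  by exists (a * c); rewrite ?mulf_neq0 // PE vE scalerA.
by exists (a / c); rewrite ?mulf_neq0 ?invr_eq0 // PE vE scalerA mulfVK.
Qed.

Variable beta : K.

Lemma vfr_mul_is_linear : linear (vfr_mul f beta).
Proof.
move=> a u v; rewrite -(vfr_invK f u) -(vfr_invK f v) -vfr_funZ -vfr_funD.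
rewrite !vfr_mulE scalerDr vfr_funD; congr (_ + _).
(* Commutativity of [K] lets [beta] pass the embedded scalar [a%:A]. *)
by rewrite -vfr_funZ !scalerA mulrC.
Qed.

HB.instance Definition _ := GRing.isLinear.Build F 'rV[F]_(r * t)
  'rV[F]_(r * t) _ (vfr_mul f beta) vfr_mul_is_linear.

Definition vfr_mul_lfun : 'End('rV[F]_(r * t)) := linfun (vfr_mul f beta).

Lemma vfr_mul_lfunE v : vfr_mul_lfun (f v) = f (beta *: v).
Proof. by rewrite lfunE /= vfr_mulE. Qed.

Hypothesis beta0 : beta != 0.

Lemma lker_vfr_mul_lfun : lker vfr_mul_lfun == 0%VS.
Proof.
apply/lker0P => u v; rewrite -(vfr_invK f u) -(vfr_invK f v) !vfr_mul_lfunE.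
by move=> /(can_inj (vfr_funK f)) /(scalerI beta0) ->.
Qed.

(** The map sends the point of [a *: v] to that of [(beta * a) *: v], and [a |-> beta * a] is a
    permutation of the nonzero elements of [K]. *)
Lemma pg_image_spread_element v :
  pg_image lker_vfr_mul_lfun @` spread_element f v = spread_element f v.
Proof.
apply/seteqP; split=> [_ [P [a a0 PE] <-]|Q [a a0 QE]].
  exists (beta * a); first exact: mulf_neq0.
  by rewrite (pg_imageE _ PE) vfr_mul_lfunE scalerA.
(* Dividing the scalar by [beta] gives the preimage within the same spread element. *)
pose w := f ((beta^-1 * a) *: v).
have hw : vfr_mul_lfun w = f (a *: v).
  by rewrite vfr_mul_lfunE scalerA mulVKf.
have w1 : \dim <[w]>%VS == 1%N.
  rewrite dim_vline eqb1; apply: contraNneq (pg_point_neq0 QE) => w0.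
  by rewrite -hw w0 linear0.
exists (exist (fun P : {vspace _} => \dim P == 1%N) _ w1).
  by exists (beta^-1 * a); rewrite // mulf_neq0 ?invr_eq0.
by apply: val_inj; rewrite QE -hw; apply: pg_imageE.
Qed.

Lemma pg_image_preserves_spread :
  preserves_spread f (pg_image lker_vfr_mul_lfun).
Proof.
apply/seteqP; split=> [_ [_ [v v0 ->] <-]|_ [v v0 ->]].
  by rewrite pg_image_spread_element; exists v.
by exists (spread_element f v); [exists v | exact: pg_image_spread_element].
Qed.

(** Since every spread element is fixed, it only remains to see that two generators [v], [w] of [P]
    determine the same one. *)
Lemma pg_image_induces_id : induces f (pg_image lker_vfr_mul_lfun) id.
Proof.
move=> P v w Pv Pw; rewrite pg_image_spread_element.
by apply: spread_element_line; [exact: pg_point_neq0 Pv | rewrite -Pv].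
Qed.

End ScalarMultiplication.

Lemma id_collineation (E : fieldType) (m : nat) :
  is_collineation (@id (pg_point E m)).
Proof.
by exists (idfun : {rmorphism E -> E}), id; split=> //; exists id.
Qed.

Theorem theorem6p6 (F : finFieldType) (K : fieldExtType F) (r t : nat)
    (dimK : \dim {:K} = t) (f : vfr_map K r t)
    (L : set (pg_point K r)) (linL : is_linear_set f L)
    (n : nat) (n_ge1 : (1 <= n)%N) :
  condition_B f L n -> condition_A f L n.
Proof.
move=> HB _ _ [U dU ->] [U' dU' ->]; rewrite !linset_pg_span => UL U'L.
(* Projective dimension [n.-1] means vector dimension [n.-1.+1], which is [n] only because [n] is
   positive. *)
rewrite (prednK n_ge1) in dU dU'.
have [beta beta0 U'E] := HB U U' dU dU' UL U'L.
exists (pg_image (lker_vfr_mul_lfun f beta0)); split.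
- exact: pg_image_PGammaL.
- rewrite pg_image_span; congr pg_span; apply/vspaceP => w.
  (* Condition (B) equates sets of vectors, so boolean membership in [U'] is first recast as
     membership in its underlying set. *)
  have -> : (w \in U') = `[< [set` U'] w >] by rewrite asboolb.
  rewrite U'E; apply/memv_imgP/asboolP => [[u uU ->]|[u uU <-]]; exists u => //.
    by rewrite lfunE.
  by rewrite lfunE.
- exact: pg_image_preserves_spread.
- by exists id; [exact: pg_image_induces_id | exact: id_collineation].
Qed.
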